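(* For every $T>0$, the control operator $W^T:\mathcal F^T\to L_2(-T,T)$, $W^TF:=u^F(\cdot,T)$, is a bounded linear bijection with bounded inverse. In particular the reachable set $U^T:=\{u^F(\cdot,T):F\in\mathcal F^T\}$ equals $L_2(-T,T)$.
   Context: Let $q\in C^2(\mathbb R)\cap L_1(\mathbb R)$ be real-valued. Let $w_1,w_2$ be real functions on $\{(x,t):|x|\le t\}$, continuous on each closed wedge $\{0\le x\le t\}$ and $\{-t\le x\le0\}$ (they are the kernels of the representation formula for the wave equation $u_{tt}-u_{xx}+q(x)u=0$, $x\ne0$, with transmission control at $x=0$; only their continuity matters here). Let $\mathcal F^T:=L_2(0,T;\mathbb R^2)$. For $F=(f_1,f_2)^\top\in\mathcal F^T$, $u^F(\cdot,T)\in L_2(-T,T)$ is defined by $u^F(x,T)=\tfrac12 f_1(T-x)-\tfrac12 f_2(T-x)+\int_x^T(w_1(x,s)f_1(T-s)+w_2(x,s)f_2(T-s))ds$ for $0<x<T$, and $u^F(x,T)=-\tfrac12 f_1(T+x)-\tfrac12 f_2(T+x)+\int_{-x}^T(w_1(x,s)f_1(T-s)+w_2(x,s)f_2(T-s))ds$ for $-T<x<0$. *)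

(* Defs.v *)
From HB Require Import structures.
From mathcomp Require Import all_boot all_order all_algebra.
From mathcomp Require Import all_classical all_reals all_analysis.
Set Implicit Arguments. Unset Strict Implicit. Unset Printing Implicit Defensive.
Import Order.TTheory GRing.Theory Num.Theory.
Import numFieldNormedType.Exports.
Local Open Scope classical_set_scope.
Local Open Scope ring_scope.

Section Defs.
Variable R : realType.
Local Notation mu := (@lebesgue_measure R).

Definition sqnorm (A : set R) (f : R -> R) : \bar R :=
  (\int[mu]_(x in A) ((f x) ^+ 2)%:E)%E.

Definition L2on (A : set R) (f : R -> R) : Prop :=
  measurable A /\ measurable_fun A f /\ (sqnorm A f < +oo)%E.

Definition ae_eq_on (A : set R) (f g : R -> R) : Prop :=
  {ae mu, forall x, A x -> f x = g x}.

Definition uF (w1 w2 : R -> R -> R) (T : R) (f1 f2 : R -> R) (x : R) : R :=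
  if 0 < x then
    f1 (T - x) / 2 - f2 (T - x) / 2
    + Rintegral mu `[x, T] (fun s => w1 x s * f1 (T - s) + w2 x s * f2 (T - s))
  else
    - (f1 (T + x) / 2) - f2 (T + x) / 2
    + Rintegral mu `[- x, T] (fun s => w1 x s * f1 (T - s) + w2 x s * f2 (T - s)).

End Defs.

(* Main.v *)
Require Import Defs.
From HB Require Import structures.
From mathcomp Require Import all_boot all_order all_algebra.
From mathcomp Require Import all_classical all_reals all_analysis.
From mathcomp Require Import measurable_realfun ring lra.
Import Order.TTheory GRing.Theory Num.Theory.
Import numFieldNormedType.Exports.
Local Open Scope classical_set_scope.
Local Open Scope ring_scope.

(** Let [phi] be the wave [u^F(., T)] would be if [w1 = w2 = 0]; up to the
    factor [sqrt 2], [F |-> phi] is an isometry of [L2(0,T)^2] onto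
    [L2(-T,T)].  Expressing [f1], [f2] through [phi] turns [W^T F] into
    [phi + V phi], where [V] is an integral operator on [L2(-T,T)] with a bounded
    kernel [k(x,s)] vanishing unless [|x| < |s|], i.e. a Volterra operator.

    Since [V] maps [L2] into bounded functions, no completeness of [L2] is
    needed: [phi + V phi = g] is solved as [phi = g - h], where
    [h = V g - V h] is a fixed point problem among bounded functions, and [V]
    halves the sup norm weighted by [exp(4 M (T - |s|))].  Likewise
    [h = V phi] satisfies [h = V g - V h], which bounds [sup |h|] by the
    [L2] norm of [g] and gives the lower bound. *)

(** * Square-integrable functions on a set of finite measure *)

Section real_integrable.
Context {d} {T : measurableType d} {R : realType}.
Context (mu : {measure set T -> \bar R}) (D : set T).
Hypothesis mD : measurable D.

Lemma integrable_EFinD (f g : T -> R) : mu.-integrable D (EFin \o f) ->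
  mu.-integrable D (EFin \o g) ->
  mu.-integrable D (EFin \o (fun x => f x + g x)).
Proof. by move=> intf intg; exact: (integrableD mD intf intg). Qed.

Lemma integrable_EFinZ (c : R) (f : T -> R) : mu.-integrable D (EFin \o f) ->
  mu.-integrable D (EFin \o (fun x => c * f x)).
Proof. by move=> intf; exact: (integrableZl mD c intf). Qed.

Lemma le_integrable_EFin (f g : T -> R) : measurable_fun D f ->
  (forall x, D x -> `|f x| <= g x) -> mu.-integrable D (EFin \o g) ->
  mu.-integrable D (EFin \o f).
Proof.
move=> mf fg; apply: le_integrable => //; first exact/measurable_EFinP.
by move=> x Dx /=; rewrite lee_fin (le_trans (fg _ Dx))// ler_norm.
Qed.

Lemma integrable_EFin_eq (f g : T -> R) : (forall x, D x -> f x = g x) ->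
  mu.-integrable D (EFin \o f) -> mu.-integrable D (EFin \o g).
Proof.
move=> fg; apply: eq_integrable => // x; rewrite inE => Dx.
by rewrite /= fg.
Qed.

End real_integrable.

Section L2_finite.
Context {R : realType} (J : set R).
Hypothesis mJ : measurable J.
Local Notation mu := (@lebesgue_measure R).
Hypothesis Jfin : (mu J < +oo)%E.

Let muJ : R := fine (mu J).

Let muJE : mu J = muJ%:E.
Proof. by rewrite fineK// ge0_fin_numE. Qed.

Lemma bounded_integrable (f : R -> R) (M : R) : measurable_fun J f ->
  (forall x, J x -> `|f x| <= M) -> mu.-integrable J (EFin \o f).
Proof.
move=> mf fM; apply: measurable_bounded_integrable => //.
exists M; split; first exact: num_real.
by move=> N MN x Jx /=; rewrite (le_trans (fM _ Jx))// ltW.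
Qed.

Lemma L2on_sqr_integrable (f : R -> R) :
  L2on J f -> mu.-integrable J (EFin \o (fun x => f x ^+ 2)).
Proof.
move=> [_ [mf foo]]; apply/integrableP; split.
  by apply/measurable_EFinP; exact: measurable_funX.
by under eq_integral do rewrite /= normrX real_normK ?num_real//.
Qed.

Lemma sqnormE (f : R -> R) : L2on J f ->
  sqnorm J f = (\int[mu]_(x in J) (f x ^+ 2))%:E.
Proof.
move=> Lf; rewrite /Rintegral fineK//.
by apply: integrable_fin_num => //; exact: L2on_sqr_integrable.
Qed.

Lemma L2on_integrable (f : R -> R) : L2on J f -> mu.-integrable J (EFin \o f).
Proof.
move=> Lf; have [_ [mf foo]] := Lf.
apply: (@le_integrable_EFin _ _ _ mu J mJ _ (fun x => 1 + f x ^+ 2)) => //.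
  move=> x Jx; rewrite -[f x ^+ 2]real_normK ?num_real//; nra.
apply: integrable_EFinD => //; last exact: L2on_sqr_integrable.
by apply: (bounded_integrable (cst 1) 1) => // x _; rewrite normr1.
Qed.

Lemma bounded_L2on (f : R -> R) (M : R) : measurable_fun J f ->
  (forall x, J x -> `|f x| <= M) -> L2on J f.
Proof.
move=> mf fM; split => //; split => //.
have /integrableP[_] : mu.-integrable J (EFin \o (fun x => f x ^+ 2)).
  apply: (@bounded_integrable _ (M ^+ 2)); first exact: measurable_funX.
  by move=> x Jx; rewrite normrX lerXn2r ?nnegrE ?fM// (le_trans _ (fM _ Jx)).
by under eq_integral do rewrite /= normrX real_normK ?num_real//.
Qed.

Lemma L2on_lin (f g : R -> R) (a b : R) : L2on J f -> L2on J g ->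
  L2on J (fun x => a * f x + b * g x).
Proof.
move=> Lf Lg; have [_ [mf _]] := Lf; have [_ [mg _]] := Lg.
have mfg : measurable_fun J (fun x => a * f x + b * g x).
  by apply: measurable_funD; exact: measurable_funM.
split => //; split => //.
have /integrableP[_] : mu.-integrable J
    (EFin \o (fun x => (a * f x + b * g x) ^+ 2)).
  apply: (@le_integrable_EFin _ _ _ mu J mJ _
      (fun x => 2 * a ^+ 2 * f x ^+ 2 + 2 * b ^+ 2 * g x ^+ 2)) => //.
  - exact: measurable_funX.
  - move=> x _; rewrite ger0_norm ?sqr_ge0//.
    by have := sqr_ge0 (a * f x - b * g x); nra.
  - by apply: integrable_EFinD => //; apply: integrable_EFinZ => //;
      exact: L2on_sqr_integrable.
by under eq_integral do rewrite /= normrX real_normK ?num_real//.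
Qed.

Lemma eq_sqnorm (f g : R -> R) : (forall x, J x -> f x = g x) ->
  sqnorm J f = sqnorm J g.
Proof. by move=> fg; apply: eq_integral => x; rewrite inE => Jx; rewrite fg. Qed.

Lemma eq_L2on (f g : R -> R) : (forall x, J x -> f x = g x) ->
  L2on J f -> L2on J g.
Proof.
move=> fg [_ [mf foo]]; split => //; split.
  by apply: eq_measurable_fun mf => x; rewrite inE; exact: fg.
by rewrite -(eq_sqnorm _ _ fg).
Qed.

(* Integrate [2 c |f| <= c ^ 2 + f ^ 2] with [c] the mean value of [|f|]. *)
Lemma sqr_Rintegral_le (f : R -> R) : L2on J f -> 
  (\int[mu]_(x in J) `|f x|) ^+ 2 <= muJ * \int[mu]_(x in J) (f x ^+ 2).
Proof.
move=> Lf; set m := \int[mu]_(x in J) `|f x|; set S := (X in _ <= _ * X).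
have m0 : 0 <= m by apply: Rintegral_ge0.
have muJ0 : 0 <= muJ by rewrite fine_ge0.
have iabs : mu.-integrable J (EFin \o (fun x => `|f x|)).
  by apply: integrable_norm; exact: L2on_integrable.
have key c : 2 * c * m <= c ^+ 2 * muJ + S.
  rewrite -Rintegral_cst//.
  have ic : mu.-integrable J (EFin \o cst (c ^+ 2)).
    by apply: (@bounded_integrable _ (c ^+ 2)) => // x _; rewrite ger0_norm ?sqr_ge0.
  rewrite -RintegralZl// -RintegralD//; last exact: L2on_sqr_integrable.
  apply: le_Rintegral => //.
  - exact: integrable_EFinZ.
  - by apply: integrable_EFinD => //; exact: L2on_sqr_integrable.
  - move=> x Jx; rewrite -[f x ^+ 2]real_normK ?num_real//.
    have := sqr_ge0 (c - `|f x|); nra.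
(* The mean value of [|f|] needs positive measure; over a null set the integral [m] vanishes. *)
have [muJ_eq0|muJ_neq0] := eqVneq muJ 0.
  suff -> : m = 0 by rewrite muJ_eq0; nra.
  have /integrableP[mabs _] := iabs.
  have mu0 : mu J = 0%E by rewrite muJE muJ_eq0.
  by rewrite /m /Rintegral null_set_integral//.
have muJp : 0 < muJ by rewrite lt_neqAle eq_sym muJ_neq0.
have := key (m / muJ); rewrite -(ler_pM2l muJp).
have -> : muJ * (2 * (m / muJ) * m) = 2 * m ^+ 2 by field.
have -> : muJ * ((m / muJ) ^+ 2 * muJ + S) = m ^+ 2 + muJ * S by field.
by lra.
Qed.

End L2_finite.

(** * Integral operators with a bounded kernel *)

Section integral_operator.
Context {R : realType} (J : set R) (k : R * R -> R) (M : R).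
Hypothesis mJ : measurable J.
Local Notation mu := (@lebesgue_measure R).
Hypothesis Jfin : (mu J < +oo)%E.
Hypothesis mk : measurable_fun [set: R * R] k.
Hypothesis kM : forall p, `|k p| <= M.

Definition intop (f : R -> R) (x : R) : R :=
  \int[mu]_(s in J) (k (x, s) * f s).

Local Notation V := intop.

Let M0 : 0 <= M. Proof. exact: le_trans (normr_ge0 _) (kM (0, 0)). Qed.

Lemma measurable_kernel_section (x : R) : measurable_fun J (fun s => k (x, s)).
Proof. by apply: measurable_funTS; exact: measurable_fun_pair2. Qed.

Lemma integrable_kernelM (f : R -> R) (x : R) :
  mu.-integrable J (EFin \o f) ->
  mu.-integrable J (EFin \o (fun s => k (x, s) * f s)).
Proof.
move=> intf; have /integrableP[/measurable_EFinP mf _] := intf.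
apply: (@le_integrable_EFin _ _ _ mu J mJ _ (fun s => M * `|f s|)) => //.
- by apply: measurable_funM => //; exact: measurable_kernel_section.
- by move=> s _; rewrite normrM ler_wpM2r.
- by apply: integrable_EFinZ => //; exact: integrable_norm.
Qed.

(** Tonelli's theorem makes the integrals of the positive and of the negative part of the
    zero-extended integrand measurable in [x]; [V f] is the real part of their difference. *)
Lemma measurable_intop (f : R -> R) : measurable_fun J f ->
  measurable_fun setT (V f).
Proof.
move=> mf; pose g := fun p : R * R => (k p * (f \_ J) p.2)%:E.
have mg : measurable_fun setT g.
  apply/measurable_EFinP; apply: measurable_funM => //.
  apply: (measurableT_comp (f := f \_ J)); last exact: measurable_snd.
  exact/(measurable_restrictT _ mJ).
have -> : V f = fine \o (fun x =>
    \int[mu]_s (g^\+%E (x, s)) - \int[mu]_s (g^\-%E (x, s)))%E.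
  apply/funext => x /=; rewrite /intop Rintegral_mkcond /Rintegral.
  rewrite (_ : (\int[mu]_s _)%E = (\int[mu]_s g (x, s))%E); last first.
    apply: eq_integral => s _; rewrite /g /= !patchE.
    by case: ifP => //; rewrite mulr0.
  by rewrite integralE; congr (fine (_ - _)%E); apply: eq_integral => s _;
    rewrite ?funeposE ?funenegE.
apply: measurableT_comp; first exact: fine_measurable.
apply: emeasurable_funB.
- apply: (@measurable_fun_fubini_tonelli_F _ _ _ (measurableTypeR R) R mu g^\+%E) => //.
  exact: measurable_funepos.
- apply: (@measurable_fun_fubini_tonelli_F _ _ _ (measurableTypeR R) R mu g^\-%E) => //.
  exact: measurable_funeneg.
Qed.

Lemma intop_lin (f g : R -> R) (a b : R) (x : R) :
  mu.-integrable J (EFin \o f) -> mu.-integrable J (EFin \o g) ->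
  V (fun s => a * f s + b * g s) x = a * V f x + b * V g x.
Proof.
move=> intf intg; rewrite /intop.
have kf := integrable_kernelM _ x intf; have kg := integrable_kernelM _ x intg.
rewrite -!RintegralZl// -RintegralD//; [|exact: integrable_EFinZ..].
by apply: eq_Rintegral => s _; ring.
Qed.

Lemma eq_intop (f g : R -> R) : (forall x, J x -> f x = g x) -> V f = V g.
Proof.
move=> fg; apply/funext => x; apply: eq_Rintegral => s; rewrite inE => Js.
by rewrite fg.
Qed.

Lemma intop_L1_le (f : R -> R) (x : R) : mu.-integrable J (EFin \o f) ->
  `|V f x| <= M * \int[mu]_(s in J) `|f s|.
Proof.
move=> intf; have kf := integrable_kernelM _ x intf.
rewrite (le_trans (le_normr_Rintegral _ _))// -RintegralZl//; last first.
  exact: integrable_norm.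
apply: le_Rintegral => //.
- exact: integrable_norm.
- by apply: integrable_EFinZ => //; exact: integrable_norm.
- by move=> s _; rewrite normrM ler_wpM2r.
Qed.

Lemma L2on_intop (f : R -> R) : L2on J f -> L2on J (V f).
Proof.
move=> Lf; apply: (@bounded_L2on _ J mJ Jfin _ (M * \int[mu]_(s in J) `|f s|)).
  by apply: measurable_funTS; apply: measurable_intop; case: Lf => _ [].
by move=> x _; apply: intop_L1_le; exact: L2on_integrable.
Qed.

(** The smoothing property of [V], from [L2] to bounded functions: the kernel bound reduces it to
    the [L1] norm, and Cauchy-Schwarz on the finite measure of [J] does the rest. *)
Lemma sqr_intop_le (f : R -> R) (x : R) : L2on J f ->
  V f x ^+ 2 <= M ^+ 2 * fine (mu J) * \int[mu]_(s in J) (f s ^+ 2).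
Proof.
move=> Lf; rewrite -real_normK ?num_real// -mulrA.
apply: (@le_trans _ _ ((M * \int[mu]_(s in J) `|f s|) ^+ 2)).
  rewrite lerXn2r ?nnegrE ?mulr_ge0//; first exact: Rintegral_ge0.
  by apply: intop_L1_le; exact: L2on_integrable.
by rewrite exprMn ler_wpM2l ?sqr_ge0//; exact: sqr_Rintegral_le.
Qed.

End integral_operator.

(** * Inversion of [1 + V] when [V] contracts a weighted sup norm *)

Lemma le_of_le_geometric {R : realType} (a b c : R) :
  (forall n, a <= b + c / 2 ^+ n) -> a <= b.
Proof.
move=> h.
have hc : (fun n => b + geometric c 2^-1 n) @ \oo --> b + 0.
  apply: cvgD; first exact: cvg_cst.
  by apply: cvg_geometric; rewrite ger0_norm; lra.
rewrite addr0 in hc.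
apply: (ler_cvg_to (cvg_cst a) hc); apply: nearW => n.
by rewrite (le_trans (h n))// /geometric /= exprVn.
Qed.

Section weighted_operator.
Context {R : realType} (J : set R) (k : R * R -> R) (M : R).
Hypothesis mJ : measurable J.
Local Notation mu := (@lebesgue_measure R).
Hypothesis Jfin : (mu J < +oo)%E.
Hypothesis mk : measurable_fun [set: R * R] k.
Hypothesis kM : forall p, `|k p| <= M.
Local Notation V := (intop J k).
(** The weight lies between [1] and [B], so the sup norm weighted by [om] is equivalent to the plain
    one; [kom] is what makes [V] halve it. *)
Context (om : R -> R) (B : R).
Hypothesis mom : measurable_fun J om.
Hypothesis om1 : forall x, J x -> 1 <= om x.
Hypothesis omB : forall x, J x -> om x <= B.
Hypothesis kom : forall x, J x ->
  \int[mu]_(s in J) (`|k (x, s)| * om s) <= om x / 2.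

Let M0 : 0 <= M. Proof. exact: le_trans (normr_ge0 _) (kM (0, 0)). Qed.

Let om0 x : J x -> 0 <= om x.
Proof. by move=> /om1; apply: le_trans. Qed.

Let weight_integrable (f : R -> R) (N : R) : measurable_fun J f ->
  (forall x, J x -> `|f x| <= N * om x) -> mu.-integrable J (EFin \o f).
Proof.
move=> mf fN; apply: (bounded_integrable J mJ Jfin _ (`|N| * B)) => // x Jx.
rewrite (le_trans (fN _ Jx))//.
rewrite (@le_trans _ _ (`|N| * om x))// ?ler_wpM2r ?om0 ?ler_norm//.
by rewrite ler_wpM2l ?omB.
Qed.

Lemma intop_weight_le (f : R -> R) (N x : R) : measurable_fun J f ->
  (forall s, J s -> `|f s| <= N * om s) -> J x -> `|V f x| <= N / 2 * om x.
Proof.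
move=> mf fN Jx.
have intf := weight_integrable _ _ mf fN.
have kf := integrable_kernelM J k M mJ mk kM _ x intf.
have N0 : 0 <= N.
  have := le_trans (normr_ge0 _) (fN _ Jx); rewrite pmulr_lge0//.
  by rewrite (lt_le_trans _ (om1 _ Jx)).
have iom : mu.-integrable J (EFin \o (fun s => `|k (x, s)| * om s)).
  apply: (@integrable_EFin_eq _ _ _ mu J mJ (fun s => `|k (x, s) * om s|)).
    by move=> s Js; rewrite normrM [X in _ * X]ger0_norm ?om0.
  apply: integrable_norm; apply: (integrable_kernelM J k M) => //.
  apply: (weight_integrable _ 1) => // s Js.
  by rewrite mul1r ger0_norm ?om0.
rewrite (le_trans (le_normr_Rintegral _ _))//.
apply: (@le_trans _ _ (N * \int[mu]_(s in J) (`|k (x, s)| * om s))); last first.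
  by rewrite -mulrA [_^-1 * _]mulrC ler_wpM2l ?kom.
rewrite -RintegralZl//; apply: le_Rintegral => //.
- exact: integrable_norm.
- exact: integrable_EFinZ.
- by move=> s Js; rewrite normrM mulrCA ler_wpM2l ?fN.
Qed.

(* Any bound [N] improves to [A + N / 2]; iterate. *)
Lemma weighted_fixpoint_le (h b : R -> R) (A N : R) : measurable_fun J h ->
  (forall x, J x -> `|h x| <= N * om x) ->
  (forall x, J x -> `|b x| <= A * om x) ->
  (forall x, J x -> h x = b x - V h x) ->
  forall x, J x -> `|h x| <= 2 * A * om x.
Proof.
move=> mh hN bA hE.
have step n : forall x, J x -> `|h x| <= (2 * `|A| + `|N| / 2 ^+ n) * om x.
  elim: n => [x Jx|n IH x Jx].
    rewrite expr0 divr1 (le_trans (hN _ Jx))// ler_wpM2r ?om0//.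
    by rewrite (le_trans (ler_norm _))// lerDr mulr_ge0.
  have := intop_weight_le h _ x mh IH Jx; have := bA _ Jx.
  rewrite hE// => bx Vx; rewrite (le_trans (ler_normB _ _))//.
  rewrite (le_trans (lerD bx Vx))//.
  have Ax : A * om x <= `|A| * om x by rewrite ler_wpM2r ?om0 ?ler_norm.
  rewrite (le_trans (lerD Ax (lexx _)))// exprS invfM le_eqVlt; apply/orP; left.
  by apply/eqP; field.
move=> x Jx; have A0 : 0 <= A.
  have := le_trans (normr_ge0 _) (bA _ Jx); rewrite pmulr_lge0//.
  by rewrite (lt_le_trans _ (om1 _ Jx)).
apply: (@le_of_le_geometric _ _ _ (`|N| * om x)) => n.
rewrite (le_trans (step n x Jx))// ger0_norm// mulrDl lerD2l.
by rewrite mulrAC.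
Qed.

(** Picard iteration from [0]. The iterates converge pointwise at a geometric rate, which keeps the
    limit measurable and lets the residual of the equation be bounded by a geometric sequence. *)
Lemma weighted_fixpoint_exists (b : R -> R) (A : R) : measurable_fun J b ->
  (forall x, J x -> `|b x| <= A * om x) ->
  exists h : R -> R, measurable_fun J h /\ (forall x, J x -> `|h x| <= 2 * A * om x) /\
    (forall x, J x -> h x = b x - V h x).
Proof.
move=> mb bA; pose u := fix u n := if n is n'.+1 then
  (fun x => b x - V (u n') x) else (fun=> 0 : R).
have mu_ n : measurable_fun J (u n).
  elim: n => [|n IH]; first exact: measurable_cst.
  apply: measurable_funB => //; apply: measurable_funTS.
  exact: measurable_intop.
(* The ball of weighted radius [2 * A] is invariant, because [A + (2 * A) / 2 = 2 * A]. *)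
have uA n x : J x -> `|u n x| <= 2 * A * om x.
  elim: n x => [|n IH] x Jx.
    by have := le_trans (normr_ge0 _) (bA _ Jx); rewrite /= normr0 -mulrA; lra.
  have := intop_weight_le (u n) _ x (mu_ n) IH Jx; have := bA _ Jx.
  move=> bx Vx; rewrite (le_trans (ler_normB _ _))// (le_trans (lerD bx Vx))//.
  lra.
have VB (f g : R -> R) (x : R) : mu.-integrable J (EFin \o f) ->
    mu.-integrable J (EFin \o g) ->
    V f x - V g x = V (fun s => f s - g s) x.
  move=> intf intg.
  rewrite -(eq_intop J k (fun s => 1 * f s + (-1) * g s) (fun s => f s - g s));
    last by move=> *; ring.
  by rewrite (intop_lin J k M)//; ring.
have intu n : mu.-integrable J (EFin \o u n) by apply: (weight_integrable _ _ _ (uA n)).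
(* Each step applies [V] to the previous difference and halves it; for [n = 0] the difference is
   [u p] itself. The bound is uniform in [p]. *)
have du n p x : J x -> `|u (n + p)%N x - u n x| <= 2 * A / 2 ^+ n * om x.
  elim: n x => [|n IH] x Jx.
    by rewrite add0n subr0 expr0 divr1 uA.
  rewrite addSn /= (_ : _ - _ = - (V (u (n + p)%N) x - V (u n) x)); last by ring.
  rewrite normrN VB//.
  have := intop_weight_le (fun s => u (n + p)%N s - u n s) _ x _ IH Jx.
  rewrite exprSr invfM mulrA; apply.
  exact: measurable_funB.
(* The iterates are partial sums of a telescoping series dominated by a geometric one. *)
have ucvg x : J x -> cvgn (fun n => u n x).
  move=> Jx; rewrite (_ : (fun n => _) =
    (fun n => u 0%N x + series (telescope (fun n => u n x)) n)); last first.
    by apply/funext => n; rewrite [LHS](eq_sum_telescope (fun n => u n x)).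
  apply: is_cvgD; first exact: is_cvg_cst.
  apply: normed_cvg.
  apply: (@series_le_cvg _ _ (geometric (2 * A * om x) 2^-1)) => //.
  - by move=> n; exact: normr_ge0.
  - move=> n; rewrite /geometric /= mulr_ge0 ?exprn_ge0//.
    exact: le_trans (normr_ge0 _) (uA 0%N _ Jx).
  - move=> n; have := du n 1%N x Jx.
    by rewrite addn1 -exprVn [X in _ <= X]mulrAC.
  - by apply: is_cvg_geometric_series; rewrite ger0_norm; lra.
pose h x := limn (fun n => u n x).
have hcvg x : J x -> u n x @[n --> \oo] --> h x by move=> /ucvg.
have mh : measurable_fun J h by apply: (measurable_fun_cvg (h := u)).
(* Let [p] tend to infinity in [du]. *)
have hu n x : J x -> `|h x - u n x| <= 2 * A / 2 ^+ n * om x.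
  move=> Jx.
  have c1 : `|u m x - u n x| @[m --> \oo] --> `|h x - u n x|.
    by apply: cvg_norm; apply: cvgB; [exact: hcvg|exact: cvg_cst].
  apply: (ler_cvg_to c1 (cvg_cst _)); near=> m.
  rewrite -(@subnKC n m) ?du//; near: m; exact: nbhs_infty_ge.
have hA x : J x -> `|h x| <= 2 * A * om x.
  by move=> Jx; have := hu 0%N x Jx; rewrite /= subr0 expr0 divr1.
exists h; split => //; split => // x Jx.
have inth := weight_integrable _ _ mh hA.
apply/eqP; rewrite -subr_eq0 -normr_le0.
apply: (@le_of_le_geometric _ _ _ (2 * A * om x)) => n; rewrite add0r.
(* Both summands are at most [2 * A / 2 ^+ n.+1 * om x]: the first by [hu], the second by
   contraction. *)
have -> : h x - (b x - V h x) = (h x - u n.+1 x) + (V h x - V (u n) x).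
  by rewrite /=; ring.
rewrite (le_trans (ler_normD _ _))// VB//.
have h1 := hu n.+1 x Jx.
have h2 := intop_weight_le (fun s => h s - u n s) _ x
  (measurable_funB mh (mu_ n)) (hu n) Jx.
rewrite (le_trans (lerD h1 h2))// exprS invfM le_eqVlt; apply/orP; left.
by apply/eqP; field.
Unshelve. all: by end_near.
Qed.

Let m : R := fine (mu J).
Let m0 : 0 <= m. Proof. exact: fine_ge0. Qed.

(** Serves both norm bounds: [(a + b) ^ 2 <= 2 a ^ 2 + 2 b ^ 2], where [b] is a value of [V f] and
    hence bounded by a constant. *)
Lemma sqr_Rintegral_le_affine (f g : R -> R) (c : R) : L2on J f -> L2on J g ->
  (forall x, J x -> f x ^+ 2 <= 2 * g x ^+ 2 + c) ->
  \int[mu]_(x in J) (f x ^+ 2) <= 2 * \int[mu]_(x in J) (g x ^+ 2) + c * m.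
Proof.
move=> Lf Lg fg; rewrite -Rintegral_cst//.
have ic : mu.-integrable J (EFin \o cst c).
  by apply: (bounded_integrable J mJ Jfin _ `|c|).
have ig := L2on_sqr_integrable J g Lg.
rewrite -RintegralZl// -RintegralD//; last exact: integrable_EFinZ.
apply: le_Rintegral => //; first exact: L2on_sqr_integrable.
by apply: integrable_EFinD => //; exact: integrable_EFinZ.
Qed.

Let L2on_addV (f : R -> R) : L2on J f -> L2on J (fun x => f x + V f x).
Proof.
move=> Lf; apply: (eq_L2on J mJ (fun x => 1 * f x + 1 * V f x)).
  by move=> x _; rewrite !mul1r.
by apply: L2on_lin => //; apply: (L2on_intop _ _ M).
Qed.

Lemma sqnorm_add_intop_le : exists C : R, 0 <= C /\ forall f : R -> R, L2on J f ->
  (sqnorm J (fun x => f x + V f x)%R <= (C ^+ 2)%:E * sqnorm J f)%E.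
Proof.
(* One factor [m] comes from [sqr_intop_le], the other from integrating that constant over [J]. *)
have C0 : 0 <= 2 + 2 * M ^+ 2 * m ^+ 2.
  by rewrite addr_ge0// !mulr_ge0// ?sqr_ge0.
exists (Num.sqrt (2 + 2 * M ^+ 2 * m ^+ 2)); split => [|f Lf].
  exact: sqrtr_ge0.
rewrite sqr_sqrtr// !sqnormE//; last exact: L2on_addV.
rewrite -EFinM lee_fin.
set S := (X in _ <= _ * X).
rewrite (le_trans (sqr_Rintegral_le_affine _ f (2 * (M ^+ 2 * m * S)) _ _ _))//.
- exact: L2on_addV.
- move=> x Jx; have := sqr_intop_le J k M mJ Jfin mk kM f x Lf.
  rewrite -/m -/S => h; have := sqr_ge0 (f x - V f x); nra.
- by rewrite le_eqVlt; apply/orP; left; apply/eqP; rewrite -/S; ring.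
Qed.

Lemma sqnorm_add_intop_ge : exists c : R, 0 < c /\ forall f : R -> R, L2on J f ->
  (c%:E * sqnorm J f <= sqnorm J (fun x => f x + V f x)%R)%E.
Proof.
(* With [g = f + V f] and [S] the integral of [g ^ 2], [|V f| <= 2 * A * B] and
   [A ^ 2 <= M ^ 2 * m * S] give [(V f) ^ 2 <= K * S]. *)
pose K := 4 * B ^+ 2 * M ^+ 2 * m.
have K0 : 0 <= K by do 3! rewrite mulr_ge0 ?sqr_ge0//.
have C0 : 0 < 2 + 2 * K * m by rewrite ltr_pwDl// mulr_ge0// mulr_ge0.
exists (2 + 2 * K * m)^-1; split => [|f Lf]; first by rewrite invr_gt0.
pose g x := f x + V f x.
have Lg : L2on J g by exact: L2on_addV.
rewrite !sqnormE// -EFinM lee_fin ler_pdivrMl//.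
set S := (X in _ <= _ * X).
have LV : L2on J (V f) by exact: (L2on_intop _ _ M).
have intf := L2on_integrable J mJ Jfin f Lf.
have intg := L2on_integrable J mJ Jfin g Lg.
have [_ [mVf _]] := LV.
pose A := M * \int[mu]_(s in J) `|g s|.
(* [V f] solves [h = V g - V h]. The crude bound through the [L1] norm of [f] only starts the
   iteration; the resulting bound involves [g] alone. *)
have HA x : J x -> `|V f x| <= 2 * A * om x.
  apply: (weighted_fixpoint_le _ (V g) _ (M * \int[mu]_(s in J) `|f s|)) => //.
  - move=> y Jy; rewrite (le_trans (intop_L1_le J k M _ _ _ f y _))//.
    rewrite ler_peMr ?om1// mulr_ge0//; exact: Rintegral_ge0.
  - move=> y Jy; rewrite (le_trans (intop_L1_le J k M _ _ _ g y _))//.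
    rewrite ler_peMr ?om1// mulr_ge0//; exact: Rintegral_ge0.
  - move=> y Jy.
    rewrite -(eq_intop J k (fun s => 1 * f s + 1 * V f s) g); last first.
      by move=> *; rewrite /g !mul1r.
    by rewrite (intop_lin J k M)//; [ring|exact: L2on_integrable].
have A2 : A ^+ 2 <= M ^+ 2 * m * S.
  rewrite exprMn -mulrA ler_wpM2l ?sqr_ge0//; exact: sqr_Rintegral_le.
rewrite (le_trans (sqr_Rintegral_le_affine _ g (2 * (K * S)) _ _ _))//.
- move=> x Jx.
  have : V f x ^+ 2 <= K * S.
    rewrite -real_normK ?num_real//.
    have A0 : 0 <= A by rewrite mulr_ge0//; exact: Rintegral_ge0.
    have A20 : 0 <= 2 * A by rewrite mulr_ge0.
    have AB0 : 0 <= 2 * A * B.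
      by rewrite mulr_ge0// (le_trans (om0 _ Jx) (omB _ Jx)).
    apply: (@le_trans _ _ ((2 * A * B) ^+ 2)).
      by rewrite lerXn2r ?nnegrE// (le_trans (HA _ Jx))// ler_wpM2l ?omB.
    rewrite (_ : (2 * A * B) ^+ 2 = 4 * B ^+ 2 * A ^+ 2); last by ring.
    rewrite (_ : K * S = 4 * B ^+ 2 * (M ^+ 2 * m * S)); last by rewrite /K; ring.
    by rewrite ler_wpM2l// mulr_ge0// sqr_ge0.
  have -> : f x = g x - V f x by rewrite /g; ring.
  have := sqr_ge0 (g x + V f x); nra.
- by rewrite le_eqVlt; apply/orP; left; apply/eqP; rewrite -/S; ring.
Qed.

Lemma add_intop_surjective (g : R -> R) : L2on J g ->
  exists f : R -> R, L2on J f /\ forall x, J x -> f x + V f x = g x.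
Proof.
move=> Lg; have LV : L2on J (V g) by exact: (L2on_intop _ _ M).
have [_ [mVg _]] := LV.
have intg := L2on_integrable J mJ Jfin g Lg.
have [|h [mh [hA hE]]] := weighted_fixpoint_exists (V g)
    (M * \int[mu]_(s in J) `|g s|) mVg.
  move=> y Jy; rewrite (le_trans (intop_L1_le J k M _ _ _ g y _))//.
  rewrite ler_peMr ?om1// mulr_ge0//; exact: Rintegral_ge0.
have inth := weight_integrable _ _ mh hA.
have Lh : L2on J h.
  apply: (eq_L2on J mJ (fun x => 1 * V g x + (-1) * V h x)).
    by move=> x Jx; rewrite hE//; ring.
  apply: L2on_lin => //; apply: (@bounded_L2on _ J mJ Jfin _ (M * \int[mu]_(s in J) `|h s|)).
    by apply: measurable_funTS; exact: measurable_intop.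
  by move=> x _; exact: intop_L1_le.
exists (fun x => 1 * g x + (-1) * h x); split; first exact: L2on_lin.
move=> x Jx; rewrite (intop_lin J k M)// {1}hE//; ring.
Qed.

End weighted_operator.

(** * Functions continuous on closed subsets of the plane *)

Section plane.
Context {R : realType}.

(** Measurability refers to the product sigma-algebra, so [U] is written as the countable union of
    the boxes with rational centre and radius [1 / (n + 1)] contained in it. *)
Lemma open_measurable_prod (U : set (R * R)) : open U -> measurable U.
Proof.
move=> oU.
pose bx (i : rat * rat * nat) : set (R * R) :=
  ball (ratr i.1.1 : R) i.2.+1%:R^-1 `*` ball (ratr i.1.2 : R) i.2.+1%:R^-1.
rewrite (_ : U = \bigcup_i (if `[< bx i `<=` U >] then bx i else set0)).
  apply: countable_bigcupT_measurable => [|i]; first exact: countableP.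
  case: ifP => _ //; apply: measurableX; exact: measurable_ball.
apply/seteqP; split=> [p Up|p [i _]]; last first.
  by case: asboolP => // iU /iU.
have /nbhs_ballP[e /= e0 eU] : nbhs p U by exact: open_nbhs_nbhs.
have e20 : 0 < e / 2 by rewrite divr_gt0.
(* A box of radius [r < e / 2] that contains [p] lies within distance [2 r < e] of [p], hence in
   [U]. *)
have [n] := ltr_add_invr e20; rewrite add0r => ne.
have r0 : 0 < n.+1%:R^-1 :> R by rewrite invr_gt0.
have bxE q1 q2 : bx (q1, q2, n) =
  ball (ratr q1 : R) n.+1%:R^-1 `*` ball (ratr q2 : R) n.+1%:R^-1 by [].
move: (n.+1%:R^-1) ne r0 bxE => r ne r0 bxE.
have p1 : p.1 - r < p.1 by lra.
have [q1] := rat_in_itvoo p1; rewrite in_itv /= => /andP[q1l q1r].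
have p2 : p.2 - r < p.2 by lra.
have [q2] := rat_in_itvoo p2; rewrite in_itv /= => /andP[q2l q2r].
exists (q1, q2, n) => //; case: asboolP => [_|[]]; rewrite bxE.
  by split; rewrite /ball /= ltr_norml; lra.
move=> x [/=]; rewrite /ball /= !ltr_norml => b1 b2.
by apply: eU; split; rewrite /ball /= ltr_norml; lra.
Qed.

Lemma within_continuous_measurable_prod (D : set (R * R)) (f : R * R -> R) :
  measurable D -> {within D, continuous f} -> measurable_fun D f.
Proof.
move=> mD /continuousP cf.
apply: (measurability _ (RGenOpens.measurableE R)).
move=> _ [_ [a [b ->] <-]].
have /open_subspaceP[V oV VD] := cf _ (interval_open (a := BRight a) (b := BLeft b) isT isT).
rewrite setIC -VD; apply: measurableI => //; exact: open_measurable_prod.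
Qed.

Lemma closed_ler_cont (f g : R * R -> R) : continuous f -> continuous g ->
  closed [set p | f p <= g p].
Proof.
move=> cf cg.
rewrite (_ : [set p | _] = (fun p => g p - f p) @^-1` [set x | 0 <= x]); last first.
  by apply/seteqP; split => p /=; rewrite subr_ge0.
apply: closed_comp; last exact: closed_ge.
by move=> p _; apply: continuousB; [exact: cg|exact: cf].
Qed.

Lemma closed_measurable_prod (D : set (R * R)) : closed D -> measurable D.
Proof.
by move=> /closed_openC /open_measurable_prod /measurableC; rewrite setCK.
Qed.

Lemma within_continuous_bounded_prod (D : set (R * R)) (f : R * R -> R) (a : R) :
  closed D -> {within D, continuous f} ->
  (forall p, D p -> `|p.1| <= a /\ `|p.2| <= a) ->
  exists M : R, forall p, D p -> `|f p| <= M.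
Proof.
move=> cD cf Da.
have kD : compact D.
  apply: (subclosed_compact cD
    (compact_setX (segment_compact (a := - a) (b := a))
                  (segment_compact (a := - a) (b := a)))).
  by move=> p /Da[]; rewrite !ler_norml => h1 h2; split; rewrite /= in_itv.
have [M [_ hM]] := compact_bounded (continuous_compact cf kD).
(* Boundedness only provides constants strictly above [M]. *)
exists (M + 1) => p Dp; apply: (hM (M + 1)); first by rewrite ltrDl.
by exists p.
Qed.

(** Outside the wedges nothing is known of [w], so it is extended by zero from [|x| < s < T]. The
    excluded points [s = |x|] and [s = T] are null for each [x], and strictness at [|x|] gives the
    Volterra property on the nose. *)
Definition wedge_truncation (w : R -> R -> R) (T : R) (p : R * R) : R :=
  if (`|p.1| < p.2) && (p.2 < T) then w p.1 p.2 else 0.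

Let wedgep : set (R * R) := [set p : R * R | 0 <= p.1 <= p.2].
Let wedgem : set (R * R) := [set p : R * R | - p.2 <= p.1 <= 0].

Let cfst : continuous (fst : R * R -> R).
Proof. by move=> p; exact: cvg_fst. Qed.
Let csnd : continuous (snd : R * R -> R).
Proof. by move=> p; exact: cvg_snd. Qed.

Let closed_wedgep : closed wedgep.
Proof.
rewrite (_ : wedgep = [set p | 0 <= p.1] `&` [set p | p.1 <= p.2]).
  by apply: closedI; apply: closed_ler_cont => //; exact: cst_continuous.
by apply/seteqP; split => p /=; move/andP.
Qed.

Let closed_wedgem : closed wedgem.
Proof.
rewrite (_ : wedgem = [set p | - p.2 <= p.1] `&` [set p | p.1 <= 0]).
  apply: closedI; apply: closed_ler_cont => //; last exact: cst_continuous.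
  by move=> p; apply: continuousN; exact: csnd.
by apply/seteqP; split => p /=; move/andP.
Qed.

Lemma wedge_truncation_measurable (w : R -> R -> R) (T : R) :
  {within wedgep, continuous (fun p => w p.1 p.2)} ->
  {within wedgem, continuous (fun p => w p.1 p.2)} ->
  measurable_fun setT (wedge_truncation w T).
Proof.
move=> cp cm; apply: measurable_fun_if => //.
- apply: measurable_and; apply: measurable_fun_ltr => //.
  by apply: measurableT_comp => //; exact: measurable_fst.
- have mw : measurable_fun (wedgep `|` wedgem) (fun p : R * R => w p.1 p.2).
    apply/measurable_funU; [exact: closed_measurable_prod..|].
    by split; apply: within_continuous_measurable_prod => //; exact: closed_measurable_prod.
  apply: measurable_funS mw.
    by apply: measurableU; exact: closed_measurable_prod.
  move=> [x s] [_ /= /andP[]]; rewrite ltr_norml => /andP[h1 h2] _.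
  by have [x0|x0] := leP 0 x; [left|right]; rewrite /wedgep /wedgem /=; lra.
Qed.

Lemma wedge_truncation_bounded (w : R -> R -> R) (T : R) :
  {within wedgep, continuous (fun p => w p.1 p.2)} ->
  {within wedgem, continuous (fun p => w p.1 p.2)} ->
  exists M, forall p, `|wedge_truncation w T p| <= M.
Proof.
(* Cutting at height [T] makes both wedges compact, since [|p.1| <= p.2 <= T] there. *)
move=> cp cm; pose below := [set p : R * R | p.2 <= T].
have cbelow : closed below by apply: closed_ler_cont => //; exact: cst_continuous.
have [Mp hMp] : exists M : R, forall p, (wedgep `&` below) p -> `|w p.1 p.2| <= M.
  apply: (within_continuous_bounded_prod _ (fun p => w p.1 p.2) T) => //.
  - exact: closedI.
  - exact: continuous_subspaceW cp.
  - move=> p [/= /andP[h1 h2] h3]; rewrite !ler_norml; rewrite /below /= in h3; split; lra.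
have [Mm hMm] : exists M : R, forall p, (wedgem `&` below) p -> `|w p.1 p.2| <= M.
  apply: (within_continuous_bounded_prod _ (fun p => w p.1 p.2) T) => //.
  - exact: closedI.
  - exact: continuous_subspaceW cm.
  - move=> p [/= /andP[h1 h2] h3]; rewrite !ler_norml; rewrite /below /= in h3; split; lra.
exists (`|Mp| + `|Mm|) => -[x s]; rewrite /wedge_truncation /=.
case: ifPn => [|_]; last by rewrite normr0 addr_ge0.
rewrite ltr_norml => /andP[/andP[h1 h2] h3].
have [x0|x0] := leP 0 x.
  have /= := hMp (x, s); rewrite /wedgep /below /= => h.
  by rewrite (le_trans (h _))//; [split; lra|rewrite (le_trans (ler_norm _))// lerDl].
have /= := hMm (x, s); rewrite /wedgem /below /= => h.
by rewrite (le_trans (h _))//; [split; lra|rewrite (le_trans (ler_norm _))// lerDr].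
Qed.

End plane.

(** * Reflections of the line *)

Section reflection.
Context {R : realType}.
Local Notation mu := (@lebesgue_measure R).

Lemma measurable_reflection (c : R) : measurable_fun setT (fun x : R => c - x).
Proof. by apply: measurable_funB => //; exact: measurable_cst. Qed.

Lemma reflection_preimage_itv (c a b : R) (ba bb : bool) :
  (fun x : R => c - x) @^-1` [set` Interval (BSide ba a) (BSide bb b)] =
  [set` Interval (BSide (~~ bb) (c - b)) (BSide (~~ ba) (c - a))].
Proof.
by apply/seteqP; split => x /=; rewrite !in_itv /=; case: ba; case: bb => /=; lra.
Qed.

(** By uniqueness of Lebesgue measure only the generating half-open intervals matter; a reflection
    exchanges their open and closed ends and keeps their length. *)
Lemma lebesgue_measure_reflection (c : R) (A : set R) : measurable A ->
  pushforward mu ((fun x : R => c - x) : _ -> measurableTypeR R) A = mu A.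
Proof.
move=> mA; apply/esym/lebesgue_measure_unique => //=.
  exact: measurable_reflection.
move=> mfn _ [[a b]] _ <-.
rewrite /pushforward reflection_preimage_itv /= !lebesgue_measure_itv /=.
rewrite !lte_fin ltrD2l ltrN2; case: ifP => // _.
by rewrite -!EFinB; congr EFin; ring.
Qed.

Lemma ge0_integral_reflection (c : R) (D : set R) (f : R -> \bar R) :
  measurable D -> measurable_fun D f -> (forall x, D x -> (0 <= f x)%E) ->
  (\int[mu]_(x in D) f x = \int[mu]_(x in (fun x => c - x)%R @^-1` D) f (c - x)%R)%E.
Proof.
move=> mD mf f0.
rewrite -(@ge0_integral_pushforward _ _ (measurableTypeR R) (measurableTypeR R)
  R _ (measurable_reflection c) mu D f)//.
  apply: eq_measure_integral; first exact: measurable_reflection.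
  by move=> mphi A mA _; exact/esym/lebesgue_measure_reflection.
by move=> x; rewrite inE; exact: f0.
Qed.

Lemma measurable_fun_reflection (c : R) (D : set R) d (U : measurableType d)
  (f : R -> U) : measurable D -> measurable_fun D f ->
  measurable_fun ((fun x => c - x) @^-1` D) (fun x => f (c - x)).
Proof.
move=> mD mf; refine (@measurable_comp _ _ _ R R U D f _ (fun x => c - x) mD _ mf _).
  by move=> _ [x Dx <-].
by apply: measurable_funTS; exact: measurable_reflection.
Qed.

Lemma integral_reflection (c : R) (D : set R) (f : R -> \bar R) :
  measurable D -> measurable_fun D f ->
  (\int[mu]_(x in D) f x = \int[mu]_(x in (fun x => c - x)%R @^-1` D) f (c - x)%R)%E.
Proof.
move=> mD mf; rewrite [LHS]integralE [RHS]integralE; congr (_ - _)%E.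
  rewrite (ge0_integral_reflection c)//; last exact: measurable_funepos.
  by apply: eq_integral => x _; rewrite !funeposE.
rewrite (ge0_integral_reflection c)//; last exact: measurable_funeneg.
by apply: eq_integral => x _; rewrite !funenegE.
Qed.

Lemma integrable_reflection (c : R) (D : set R) (f : R -> \bar R) :
  measurable D -> mu.-integrable D f ->
  mu.-integrable ((fun x => c - x) @^-1` D) (fun x => f (c - x)).
Proof.
move=> mD /integrableP[mf foo]; apply/integrableP; split.
  exact: measurable_fun_reflection.
by rewrite -(ge0_integral_reflection c D (fun x => `|f x|)%E)//; exact: measurableT_comp.
Qed.

(** The interval is folded at [0]: the null point [0] is dropped and the left half is reflected onto
    the right one. *)
Lemma ge0_integral_symmetric_itv (T : R) (g : R -> \bar R) : 0 < T ->
  measurable_fun `]-T, T[ g -> (forall x, `]-T, T[%classic x -> (0 <= g x)%E) ->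
  (\int[mu]_(x in `](-T)%R, T[) g x =
   \int[mu]_(x in `]0%R, T[) (g x + g (0 - x)%R))%E.
Proof.
move=> T0 mg g0.
have sub1 : `](-T), 0[%classic `<=` `](-T), T[%classic.
  by move=> x; rewrite /= !in_itv /=; lra.
have sub2 : `]0, T[%classic `<=` `](-T), T[%classic.
  by move=> x; rewrite /= !in_itv /=; lra.
have pre : (fun x : R => 0 - x) @^-1` `](-T), 0[%classic = `]0, T[%classic.
  by rewrite reflection_preimage_itv !sub0r opprK oppr0.
have JE : `](-T), T[%classic = `](-T), 0]%classic `|` `]0, T[%classic.
  by apply: itv_bndbnd_setU; rewrite bnd_simp; lra.
rewrite JE ge0_integral_setU//; first last.
- apply/disj_setPS => x [/=]; rewrite !in_itv /=; lra.
- by rewrite -JE.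
- by rewrite -JE.
rewrite -integral_itv_bndo_bndc; last exact: measurable_funS mg.
rewrite (ge0_integral_reflection 0 `](-T), 0[)//; first last.
- by move=> x /sub1; exact: g0.
- exact: measurable_funS mg.
rewrite pre addeC ge0_integralD//.
- by move=> x /sub2; exact: g0.
- exact: measurable_funS mg.
- by move=> x Ix; apply/g0/sub1; rewrite -pre in Ix.
- by rewrite -pre; apply: measurable_fun_reflection => //; exact: measurable_funS mg.
Qed.

Lemma integrable_symmetric_itv (T : R) (g : R -> R) : 0 < T ->
  mu.-integrable `]-T, T[ (EFin \o g) ->
  mu.-integrable `]0, T[ (EFin \o g) /\
  mu.-integrable `]0, T[ (EFin \o (fun x => g (- x))).
Proof.
move=> T0 ig; split.
  by apply: (integrableS _ _ _ ig) => // x; rewrite /= !in_itv /=; lra.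
have pre : (fun x : R => 0 - x) @^-1` `](-T), 0[%classic = `]0, T[%classic.
  by rewrite reflection_preimage_itv !sub0r opprK oppr0.
rewrite -pre.
have : mu.-integrable `](-T), 0[ (EFin \o g).
  by apply: (integrableS _ _ _ ig) => // x; rewrite /= !in_itv /=; lra.
have mpre : measurable ((fun x : R => 0 - x) @^-1` `](-T), 0[%classic).
  by rewrite pre.
move/(integrable_reflection 0 `](-T), 0[%classic (EFin \o g) (measurable_itv _)).
by apply: eq_integrable => // x _; rewrite /= sub0r.
Qed.

Lemma Rintegral_symmetric_itv (T : R) (g : R -> R) : 0 < T ->
  mu.-integrable `]-T, T[ (EFin \o g) ->
  \int[mu]_(x in `](-T)%R, T[) g x =
  \int[mu]_(x in `]0%R, T[) (g x + g (- x)).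
Proof.
move=> T0 ig; have [i1 i2] := integrable_symmetric_itv T g T0 ig.
have pre : (fun x : R => 0 - x) @^-1` `](-T), 0[%classic = `]0, T[%classic.
  by rewrite reflection_preimage_itv !sub0r opprK oppr0.
rewrite RintegralD// addrC.
have -> : \int[mu]_(x in `]0, T[) g (- x) = \int[mu]_(x in `](-T)%R, 0[) g x.
  rewrite /Rintegral (integral_reflection 0 `](-T), 0[)//.
    by rewrite pre; congr fine; apply: eq_integral => x _; rewrite sub0r.
  have : mu.-integrable `](-T), 0[ (EFin \o g).
    by apply: (integrableS _ _ _ ig) => // x; rewrite /= !in_itv /=; lra.
  exact: measurable_int.
rewrite -(@Rintegral_itvB R g (BRight (-T)) (BLeft T) 0)//; [|by rewrite bnd_simp; lra..].
rewrite (@Rintegral_itv_bndo_bndc R (BRight (-T)) 0); last first.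
  by apply: (integrableS _ _ _ ig) => // x; rewrite /= !in_itv /=; lra.
by rewrite addrC subrK.
Qed.

End reflection.

(** * Square norms under reflection and their null functions *)

Section L2_reflection.
Context {R : realType}.
Local Notation mu := (@lebesgue_measure R).

Lemma L2on_subset (D E : set R) (f : R -> R) : measurable D -> D `<=` E ->
  L2on E f -> L2on D f.
Proof.
move=> mD DE [mE [mf foo]]; split => //; split; first exact: measurable_funS mf.
apply: le_lt_trans foo; apply: ge0_subset_integral => //.
- by apply/measurable_EFinP; exact: measurable_funX.
- by move=> x _; rewrite lee_fin sqr_ge0.
Qed.

Lemma sqnorm_reflection (c : R) (D : set R) (f : R -> R) :
  measurable D -> measurable_fun D f ->
  sqnorm D f = sqnorm ((fun x => c - x) @^-1` D) (fun x => f (c - x)).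
Proof.
move=> mD mf; apply: ge0_integral_reflection => //.
- by apply/measurable_EFinP; exact: measurable_funX.
- by move=> x _; rewrite lee_fin sqr_ge0.
Qed.

Lemma L2on_reflection (c : R) (D : set R) (f : R -> R) : L2on D f ->
  L2on ((fun x => c - x) @^-1` D) (fun x => f (c - x)).
Proof.
move=> [mD [mf foo]]; split.
  by rewrite -[X in measurable X]setTI; apply: measurable_reflection.
split; first exact: measurable_fun_reflection.
by rewrite -sqnorm_reflection.
Qed.

Lemma sqnorm_eq0 (D : set R) (f : R -> R) : measurable D -> measurable_fun D f ->
  sqnorm D f = 0%E <-> ae_eq_on D f (fun=> 0).
Proof.
move=> mD mf.
have mf2 : measurable_fun D (fun x => (f x ^+ 2)%:E).
  by apply/measurable_EFinP; exact: measurable_funX.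
have -> : sqnorm D f = (\int[mu]_(x in D) `|(f x ^+ 2)%:E|)%E.
  by apply: eq_integral => x _; rewrite /= ger0_norm ?sqr_ge0.
split.
  move/(ae_eq_integral_abs mu mD mf2); apply: filterS => x h Dx.
  by have := h Dx => -[] /eqP; rewrite sqrf_eq0 => /eqP.
move=> h; apply/(ae_eq_integral_abs mu mD mf2); move: h.
apply: filterS => [|x h Dx]; first exact: (ae_filter_ringOfSetsType mu).
by rewrite h// expr0n.
Qed.

End L2_reflection.

(** * The integral of the exponential weight *)

Section exponential_weight.
Context {R : realType}.
Local Notation mu := (@lebesgue_measure R).

(** The rate [4 * M] is chosen for this: a kernel of total size [2 * M] acting beyond [a] returns
    less than half of the weight at [a]. The primitive is [F], and the integrand is [- (4 * M) * F],
    so continuity of one gives that of the other. *)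
Lemma Rintegral_expR_itv (M T a : R) : 0 < M -> a < T ->
  \int[mu]_(s in `[a, T]) (2 * M * expR (4 * M * (T - s))) =
  (expR (4 * M * (T - a)) - 1) / 2.
Proof.
move=> M0 aT.
pose F s : R := - (expR (4 * M * (T - s)) / 2).
have dF (s : R) : is_derive s 1 F (2 * M * expR (4 * M * (T - s))).
  rewrite /F; apply: is_derive_eq.
  by rewrite /GRing.scale /=; field.
have cF : continuous F.
  move=> s; apply: differentiable_continuous; apply/derivable1_diffP.
  by have [] := dF s.
have fE : (fun s => 2 * M * expR (4 * M * (T - s))) = (fun s => - (4 * M) * F s).
  by apply/funext => s; rewrite /F; field.
rewrite /Rintegral (@continuous_FTC2 _ _ F)//.
- by rewrite -EFinB /= /F subrr mulr0 expR0; field.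
- rewrite fE; apply: continuous_subspaceT => s.
  by apply: cvgM; [exact: cvg_cst|exact: cF].
- split.
  + by move=> x _; have [] := dF x.
  + by apply: cvg_at_right_filter; exact: cF.
  + by apply: cvg_at_left_filter; exact: cF.
- by move=> x _; rewrite derive1E; have [_ ->] := dF x.
Qed.

End exponential_weight.

(** * The Volterra form of the control operator *)

Section transmission.
Context {R : realType}.
Local Notation mu := (@lebesgue_measure R).
Context (T : R) (T0 : 0 < T).
Local Notation I := (`]0, T[%classic : set R).
Local Notation J := (`](- T), T[%classic : set R).

Definition free_wave (f1 f2 : R -> R) (x : R) : R :=
  if 0 < x then f1 (T - x) / 2 - f2 (T - x) / 2
  else - (f1 (T + x) / 2) - f2 (T + x) / 2.

Let free_waveP (f1 f2 : R -> R) (s : R) : 0 < s ->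
  free_wave f1 f2 s = f1 (T - s) / 2 - f2 (T - s) / 2.
Proof. by move=> s0; rewrite /free_wave s0. Qed.

Let free_waveN (f1 f2 : R -> R) (s : R) : 0 <= s ->
  free_wave f1 f2 (- s) = - (f1 (T - s) / 2) - f2 (T - s) / 2.
Proof. by move=> s0; rewrite /free_wave oppr_gt0 ltNge s0. Qed.

Let preI : (fun x : R => T - x) @^-1` I = I.
Proof. by rewrite reflection_preimage_itv /= subrr subr0. Qed.

Let preN : (fun x : R => 0 - x) @^-1` I = `](-T), 0[%classic.
Proof. by rewrite reflection_preimage_itv /= !sub0r oppr0. Qed.

Let preP : (fun x : R => 0 - x) @^-1` `](-T), 0[%classic = I.
Proof. by rewrite reflection_preimage_itv /= !sub0r opprK oppr0. Qed.

Let measurable_free_wave (f1 f2 : R -> R) : measurable_fun I f1 ->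
  measurable_fun I f2 -> measurable_fun J (free_wave f1 f2).
Proof.
have rI (f : R -> R) : measurable_fun I f -> measurable_fun I (fun x => f (T - x)).
  by move=> mf; rewrite -[X in measurable_fun X]preI; exact: measurable_fun_reflection.
have rN (f : R -> R) : measurable_fun I f ->
    measurable_fun `](-T), 0[ (fun x => f (T - (0 - x))).
  move=> mf; rewrite -preN.
  by apply: (measurable_fun_reflection 0 I _ _ (fun x => f (T - x))) => //; exact: rI.
move=> m1 m2.
have -> : J = `](-T), 0[%classic `|` [set 0] `|` I.
  apply/seteqP; split => x /=; rewrite !in_itv /=.
    by move=> xJ; have [x0|x0|->] := ltgtP x 0; [left; left|right|left; right]; lra.
  by move=> [[h|->]|h]; [lra|rewrite oppr_lt0 T0|lra].
apply/measurable_funU; [by apply: measurableU| by []|split].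
  apply/measurable_funU => //; split; last exact: measurable_fun_set1.
  apply: (@eq_measurable_fun _ _ R R `](-T), 0[%classic
    (fun x => - (f1 (T - (0 - x)) / 2) - f2 (T - (0 - x)) / 2)).
    move=> x; rewrite inE /= in_itv /= => /andP[_ x0].
    by rewrite /free_wave ltNge (ltW x0) /= sub0r opprK.
  apply: measurable_funB; first apply: measurableT_comp => //.
    by apply: measurable_funM => //; exact: rN.
  by apply: measurable_funM => //; exact: rN.
apply: (@eq_measurable_fun _ _ R R I (fun x => f1 (T - x) / 2 - f2 (T - x) / 2)).
  by move=> x; rewrite inE /= in_itv /= => /andP[x0 _]; rewrite free_waveP.
by apply: measurable_funB; apply: measurable_funM => //; exact: rI.
Qed.

(** After folding at [0] this is the parallelogram identity: the values at [s] and [-s] are half the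
    difference and minus half the sum of [f1 (T - s)] and [f2 (T - s)]. *)
Lemma sqnorm_free_wave (f1 f2 : R -> R) : measurable_fun I f1 ->
  measurable_fun I f2 ->
  (2%:E * sqnorm J (free_wave f1 f2) = sqnorm I f1 + sqnorm I f2)%E.
Proof.
move=> m1 m2; have mw := measurable_free_wave _ _ m1 m2.
have rI (f : R -> R) : measurable_fun I f ->
    measurable_fun I (fun x => (f (T - x) ^+ 2)%:E).
  move=> mf; apply/measurable_EFinP; apply: measurable_funX.
  by rewrite -[X in measurable_fun X]preI; exact: measurable_fun_reflection.
rewrite (sqnorm_reflection T _ f1)// (sqnorm_reflection T _ f2)// preI.
rewrite /sqnorm -ge0_integralD//; first last.
- exact: rI.
- by move=> x _; rewrite lee_fin sqr_ge0.
- exact: rI.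
- by move=> x _; rewrite lee_fin sqr_ge0.
rewrite -ge0_integralZl//; first last.
- by move=> x _; rewrite lee_fin sqr_ge0.
- by apply/measurable_EFinP; exact: measurable_funX.
rewrite ge0_integral_symmetric_itv//; first last.
- by move=> x _; rewrite -EFinM lee_fin mulr_ge0// sqr_ge0.
- apply/measurable_EFinP; apply: measurable_funM => //; exact: measurable_funX.
apply: eq_integral => s; rewrite inE /= in_itv /= => /andP[s0 _].
rewrite sub0r free_waveP// free_waveN ?ltW// -!EFinM -!EFinD; congr EFin.
by field.
Qed.

Lemma L2on_free_wave (f1 f2 : R -> R) : L2on I f1 -> L2on I f2 ->
  L2on J (free_wave f1 f2).
Proof.
move=> [_ [m1 f1oo]] [_ [m2 f2oo]]; split => //; split.
  exact: measurable_free_wave.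
have : (2%:E * sqnorm J (free_wave f1 f2) < +oo)%E.
  by rewrite sqnorm_free_wave// lte_add_pinfty.
apply: le_lt_trans; rewrite lee_pemull//; last by rewrite lee_fin; lra.
by apply: integral_ge0 => x _; rewrite lee_fin sqr_ge0.
Qed.

Lemma free_wave_surjective (phi : R -> R) : L2on J phi ->
  exists f1 f2 : R -> R, L2on I f1 /\ L2on I f2 /\ free_wave f1 f2 = phi.
Proof.
move=> Lphi.
have Lp : L2on I (fun t => phi (T - t)).
  rewrite -preI; apply: L2on_reflection; apply: L2on_subset Lphi => // x /=.
  by rewrite !in_itv /=; lra.
have Lm : L2on I (fun t => phi (0 - (T - t))).
  rewrite -preI; apply: (L2on_reflection T I (fun t => phi (0 - t))).
  rewrite -preP; apply: L2on_reflection; apply: L2on_subset Lphi => // x /=.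
  by rewrite !in_itv /=; lra.
(* The two-by-two system for the values at [s] and [-s], solved with [s = T - t]; the coefficients
   are spelled out to fit [L2on_lin]. *)
exists (fun t => 1 * phi (T - t) + (-1) * phi (0 - (T - t))).
exists (fun t => (-1) * phi (T - t) + (-1) * phi (0 - (T - t))).
split; first exact: L2on_lin.
split; first exact: L2on_lin.
apply/funext => x; rewrite /free_wave; case: ifP => _.
  by rewrite (_ : T - (T - x) = x); [field|ring].
by rewrite (_ : 0 - (T - (T + x)) = x); [field|ring].
Qed.

Context (w1 w2 : R -> R -> R).
Let v1 := wedge_truncation w1 T.
Let v2 := wedge_truncation w2 T.

(* The coefficient of [phi s] after substituting [f1 (T - s) = phi s - phi (- s)]
   and [f2 (T - s) = - phi s - phi (- s)] for [s > 0]; the truncations vanish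
   unless their second argument is positive. *)
Definition wave_kernel (p : R * R) : R :=
  v1 p - v2 p - v1 (p.1, - p.2) - v2 (p.1, - p.2).

Let wedge_truncation0 (w : R -> R -> R) (x s : R) : s <= `|x| ->
  wedge_truncation w T (x, s) = 0.
Proof. by move=> sx; rewrite /wedge_truncation /= ltNge sx. Qed.

(** The Volterra property: the four truncations are taken at [s] or [-s], and neither exceeds
    [|x|]. *)
Lemma wave_kernel_eq0 (x s : R) : `|s| <= `|x| -> wave_kernel (x, s) = 0.
Proof.
move=> sx; rewrite /wave_kernel /v1 /v2 /= !wedge_truncation0; first by ring.
all: by rewrite (le_trans _ sx)// ler_normr lexx ?orbT.
Qed.

(** Folding the integral over [J] at [0] pairs the contributions of [s] and [-s]. For [s > 0] the
    truncations at [-s] vanish, and what remains is the integrand [h] of [uF], restricted to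
    [|x| < s < T]. *)
Lemma uF_free_wave (f1 f2 : R -> R) (x : R) :
  mu.-integrable J (EFin \o (fun s => wave_kernel (x, s) * free_wave f1 f2 s)) ->
  J x -> uF w1 w2 T f1 f2 x =
    free_wave f1 f2 x + intop J wave_kernel (free_wave f1 f2) x.
Proof.
move=> ik; rewrite /= in_itv /= => /andP[xl xr].
have aT : `|x| < T by rewrite ltr_norml xl.
pose h s := w1 x s * f1 (T - s) + w2 x s * f2 (T - s).
have hE s : I s -> wave_kernel (x, s) * free_wave f1 f2 s +
    wave_kernel (x, - s) * free_wave f1 f2 (- s) = (h \_ `]`|x|, T[) s.
  rewrite /= in_itv /= => /andP[s0 sT]; rewrite patchE mem_setE in_itv /= sT andbT.
  rewrite free_waveP// free_waveN ?ltW// /wave_kernel /= opprK.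
  have z w : wedge_truncation w T (x, - s) = 0.
    by rewrite wedge_truncation0// (@le_trans _ _ 0)// oppr_le0 ltW.
  rewrite /v1 /v2 !z /wedge_truncation /= sT andbT /h.
  (* Off its set the restriction takes the default value [point], which is [0] in [R]. *)
  by case: ifP => _; [field|have -> : (point : R) = 0 by []; ring].
have [i1 i2] := integrable_symmetric_itv T _ T0 ik.
have sub : `]`|x|, T[%classic `<=` I.
  move=> y /=; rewrite !in_itv /= => /andP[xy ->]; rewrite andbT.
  by rewrite (le_lt_trans _ xy).
have ih : mu.-integrable `]`|x|, T[ (EFin \o h).
  pose g s := wave_kernel (x, s) * free_wave f1 f2 s +
    wave_kernel (x, - s) * free_wave f1 f2 (- s).
  have i3 : mu.-integrable I (EFin \o g) by exact: integrable_EFinD.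
  apply: (@integrable_EFin_eq _ _ _ mu _ _ g) => //.
    by move=> s xs; rewrite /g hE; [rewrite patchE mem_set|exact: sub].
  by apply: (integrableS _ _ _ i3).
have -> : intop J wave_kernel (free_wave f1 f2) x =
    \int[mu]_(s in `[`|x|, T]) h s.
  rewrite /intop Rintegral_symmetric_itv//.
  rewrite (@eq_Rintegral _ _ _ mu I (h \_ `]`|x|, T[)); last first.
    by move=> s; rewrite inE; exact: hE.
  rewrite -Rintegral_mkcondr setIidr//.
  rewrite (@Rintegral_itv_obnd_cbnd R `|x| (BLeft T))//.
  rewrite (@Rintegral_itv_bndo_bndc R (BLeft `|x|) T)//.
  (* Closing the interval at [T] asks for integrability on the half-open one, so the single point
     [|x|] is added to the open interval. *)
  have mh : measurable_fun `]`|x|, T[ h by have /measurable_int/measurable_EFinP := ih.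
  have mh' : measurable_fun `[`|x|, T[ h.
    rewrite -(@setU1itv _ _ (BLeft T) `|x| false) ?bnd_simp//; apply/measurable_funU => //; split => //.
    exact: measurable_fun_set1.
  apply/integrableP; split; first exact/measurable_EFinP.
  rewrite -integral_itv_obnd_cbnd; first by have /integrableP[] := ih.
  by apply: measurableT_comp => //; exact/measurable_EFinP.
(* In both branches of [uF] the lower limit of integration is [|x|]. *)
rewrite /uF /free_wave; case: ltP => x0; first by rewrite gtr0_norm.
by rewrite ler0_norm.
Qed.

(** The weight is even, so folding leaves [|k (x, s)| + |k (x, - s)|], which is at most [2 * M] and
    vanishes for [s <= |x|]; the explicit integral from [|x|] to [T] then gives the factor one
    half. *)
Lemma intop_wave_kernel_weight (M x : R) : measurable_fun setT wave_kernel ->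
  0 < M -> (forall p, `|wave_kernel p| <= M) -> J x ->
  \int[mu]_(s in J) (`|wave_kernel (x, s)| * expR (4 * M * (T - `|s|))) <=
  expR (4 * M * (T - `|x|)) / 2.
Proof.
move=> mk M0 kM; rewrite /= in_itv /= => /andP[xl xr].
have aT : `|x| < T by rewrite ltr_norml xl.
have M40 : 0 <= 4 * M by rewrite mulr_ge0 ?ltW.
have M20 : 0 <= 2 * M by rewrite mulr_ge0 ?ltW.
pose om (s : R) := expR (4 * M * (T - `|s|)).
have omB s : om s <= expR (4 * M * T).
  by rewrite ler_expR ler_wpM2l// gerBl.
have muJoo : (mu J < +oo)%E.
  by rewrite lebesgue_measure_itv /= lte_fin; case: ifP => _; rewrite ?ltry.
have mom c : measurable_fun setT (fun s : R => expR (c * (T - s))).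
  apply: measurableT_comp => //; apply: measurable_funM => //.
  exact: measurable_reflection.
have ig : mu.-integrable J (EFin \o (fun s => `|wave_kernel (x, s)| * om s)).
  apply: (@bounded_integrable _ J _ muJoo _ (M * expR (4 * M * T))) => //.
    apply: measurable_funTS; apply: measurable_funM.
      by apply: measurableT_comp => //; exact: measurable_fun_pair2.
    apply: (measurableT_comp (mom _)); exact: normr_measurable.
  move=> s _; rewrite normrM normr_id ler_pM ?kM// [leLHS]ger0_norm ?expR_ge0 ?omB//.
(* Majorant of the folded integrand on [|x| < s < T]. *)
pose h (s : R) := 2 * M * expR (4 * M * (T - s)).
have mh : measurable_fun setT h by apply: measurable_funM => //; exact: mom.
have h0 s : 0 <= h s by rewrite mulr_ge0 ?expR_ge0.
have hB s : 0 <= s -> h s <= 2 * M * expR (4 * M * T).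
  by move=> s0; rewrite ler_wpM2l// ler_expR ler_wpM2l// gerBl.
have sub : `]`|x|, T[%classic `<=` I.
  move=> y /=; rewrite !in_itv /= => /andP[xy ->]; rewrite andbT.
  by rewrite (le_lt_trans _ xy).
have ih (D : set R) : measurable D -> D `<=` `[0, T] -> mu.-integrable D (EFin \o h).
  move=> mD DT.
  have muDoo : (mu D < +oo)%E.
    rewrite (@le_lt_trans _ _ (mu `[0, T]))//; first by rewrite le_measure ?inE.
    by rewrite lebesgue_measure_itv /= lte_fin; case: ifP => _; rewrite ?ltry.
  apply: (@bounded_integrable _ D mD muDoo _ (2 * M * expR (4 * M * T))) => //.
    exact: measurable_funTS.
  by move=> s /DT; rewrite /= in_itv /= => /andP[s0 _]; rewrite ger0_norm ?hB.
have [i1 i2] := integrable_symmetric_itv T _ T0 ig.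
rewrite Rintegral_symmetric_itv//.
apply: (@le_trans _ _ (\int[mu]_(s in I) (h \_ `]`|x|, T[) s)).
  apply: le_Rintegral => //.
  - exact: integrable_EFinD.
  - rewrite -restrict_EFin; apply/integrable_restrict => //.
    by apply: ih => [|y [/=]]; [exact: measurableI|rewrite !in_itv /=; lra].
  - move=> s /=; rewrite in_itv /= => /andP[s0 sT].
    rewrite patchE mem_setE in_itv /= sT andbT normrN (gtr0_norm s0).
    case: ltP => sx.
      have := kM (x, s); have := kM (x, - s); have := expR_ge0 (4 * M * (T - s)).
      rewrite /h /om; nra.
    by rewrite !wave_kernel_eq0 ?normrN ?(gtr0_norm s0)// !normr0 !mul0r addr0.
rewrite -Rintegral_mkcondr setIidr//.
rewrite (@Rintegral_itv_obnd_cbnd R `|x| (BLeft T)); last first.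
  by apply: ih => // y /=; rewrite !in_itv /=; have := normr_ge0 x; lra.
rewrite (@Rintegral_itv_bndo_bndc R (BLeft `|x|) T); last first.
  by apply: ih => // y /=; rewrite !in_itv /=; have := normr_ge0 x; lra.
rewrite Rintegral_expR_itv//; have := expR_ge0 (4 * M * (T - `|x|)); lra.
Qed.

End transmission.

(** * Bijectivity of the control operator and its two-sided bounds *)

Theorem mainTheorem3 (R : realType) (w1 w2 : R -> R -> R)
  (hw1p : {within [set p : R * R | 0 <= p.1 <= p.2], continuous (fun p => w1 p.1 p.2)})
  (hw1m : {within [set p : R * R | - p.2 <= p.1 <= 0], continuous (fun p => w1 p.1 p.2)})
  (hw2p : {within [set p : R * R | 0 <= p.1 <= p.2], continuous (fun p => w2 p.1 p.2)})
  (hw2m : {within [set p : R * R | - p.2 <= p.1 <= 0], continuous (fun p => w2 p.1 p.2)})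
  (T : R) (hT : 0 < T) :
  let I : set R := `]0, T[%classic in
  let J : set R := `](- T), T[%classic in
  let W := uF w1 w2 T in
  let FT := fun f1 f2 => L2on I f1 /\ L2on I f2 in
  let nF := fun f1 f2 => (sqnorm I f1 + sqnorm I f2)%E in
  (* W^T maps F^T into L2(-T,T) *)
  (forall f1 f2, FT f1 f2 -> L2on J (W f1 f2)) /\
  (* linearity *)
  (forall f1 f2 g1 g2 (a b : R), FT f1 f2 -> FT g1 g2 ->
     ae_eq_on J (W (fun t => a * f1 t + b * g1 t) (fun t => a * f2 t + b * g2 t))
                          (fun x => a * W f1 f2 x + b * W g1 g2 x)) /\
  (* boundedness *)
  (exists C : R, 0 <= C /\ forall f1 f2, FT f1 f2 ->
     (sqnorm J (W f1 f2) <= (C ^+ 2)%:E * nF f1 f2)%E) /\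
  (* injectivity (modulo a.e. equality) *)
  (forall f1 f2 g1 g2, FT f1 f2 -> FT g1 g2 ->
     ae_eq_on J (W f1 f2) (W g1 g2) ->
     ae_eq_on I f1 g1 /\ ae_eq_on I f2 g2) /\
  (* surjectivity: U^T = L2(-T,T) *)
  (forall g, L2on J g ->
     exists f1 f2, FT f1 f2 /\ ae_eq_on J (W f1 f2) g) /\
  (* bounded inverse *)
  (exists c : R, 0 < c /\ forall f1 f2, FT f1 f2 ->
     (c%:E * nF f1 f2 <= sqnorm J (W f1 f2))%E)
.
Proof.
move=> I J W FT nF.
pose mu := @lebesgue_measure R.
have mI : measurable I by exact: measurable_itv.
have mJ : measurable J by exact: measurable_itv.
have Jfin : (mu J < +oo)%E.
  by rewrite /mu lebesgue_measure_itv /= lte_fin; case: ifP => _; rewrite ?ltry.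
pose k := wave_kernel T w1 w2.
have mv1 := wedge_truncation_measurable w1 T hw1p hw1m.
have mv2 := wedge_truncation_measurable w2 T hw2p hw2m.
have mk : measurable_fun setT k.
  have mrefl : measurable_fun setT (fun p : R * R => (p.1, - p.2)).
    apply: measurable_fun_pair; first exact: measurable_fst.
    by apply: measurableT_comp => //; exact: measurable_snd.
  apply: measurable_funB; first apply: measurable_funB; first exact: measurable_funB.
    exact: (measurableT_comp mv1 mrefl).
  exact: (measurableT_comp mv2 mrefl).
have [M1 hM1] := wedge_truncation_bounded w1 T hw1p hw1m.
have [M2 hM2] := wedge_truncation_bounded w2 T hw2p hw2m.
(* The kernel is a sum of four truncations, two for each of [w1] and [w2]; the extra [1] makes [M]
   positive, as the exponential weight requires. *)
pose M := 2 * (M1 + M2) + 1.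
have M0 : 0 < M.
  have := le_trans (normr_ge0 _) (hM1 (0, 0)).
  have := le_trans (normr_ge0 _) (hM2 (0, 0)); rewrite /M; lra.
have kM p : `|k p| <= M.
  have := hM1 p; have := hM2 p; have := hM1 (p.1, - p.2); have := hM2 (p.1, - p.2).
  by rewrite /k /wave_kernel /M !ler_norml; lra.
pose om (s : R) := expR (4 * M * (T - `|s|)).
have mom : measurable_fun J om.
  apply: measurable_funTS; apply: measurableT_comp => //.
  apply: measurable_funM => //; apply: measurable_funB => //.
have om1 x : J x -> 1 <= om x.
  rewrite /J /= in_itv /= => /andP[xl xr].
  rewrite -expR0 ler_expR mulr_ge0 ?subr_ge0//; first by rewrite mulr_ge0 ?ltW.
  by rewrite ler_norml !ltW.
have omB x : J x -> om x <= expR (4 * M * T).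
  by move=> _; rewrite ler_expR ler_wpM2l ?mulr_ge0 ?(ltW M0)// gerBl.
have kom x (Jx : J x) := intop_wave_kernel_weight T hT w1 w2 M x mk M0 kM Jx.
have [C [C0 hC]] := sqnorm_add_intop_le J k M mJ Jfin mk kM.
have [c [c0 hc]] := sqnorm_add_intop_ge J k M mJ Jfin mk kM om
  (expR (4 * M * T)) mom om1 omB kom.
have surj := add_intop_surjective J k M mJ Jfin mk kM om
  (expR (4 * M * T)) mom om1 omB kom.
pose Phi := free_wave T.
have LPhi f1 f2 : FT f1 f2 -> L2on J (Phi f1 f2).
  by move=> [? ?]; exact: L2on_free_wave.
have nPhi f1 f2 : FT f1 f2 -> (2%:E * sqnorm J (Phi f1 f2))%E = nF f1 f2.
  by move=> [[_ [? _]] [_ [? _]]]; exact: sqnorm_free_wave.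
have WE f1 f2 : FT f1 f2 -> forall x, J x ->
    W f1 f2 x = Phi f1 f2 x + intop J k (Phi f1 f2) x.
  move=> F x Jx; apply: uF_free_wave => //.
  apply: (integrable_kernelM J k M) => //.
  by apply: L2on_integrable => //; exact: LPhi.
have WL f1 f2 : FT f1 f2 -> L2on J (W f1 f2).
  move=> F; have LF := LPhi _ _ F.
  apply: (eq_L2on J mJ (fun x => 1 * Phi f1 f2 x + 1 * intop J k (Phi f1 f2) x)).
    by move=> x Jx; rewrite WE// !mul1r.
  by apply: L2on_lin => //; exact: (L2on_intop _ _ M).
have FTlin f1 f2 g1 g2 (a b : R) : FT f1 f2 -> FT g1 g2 ->
    FT (fun t => a * f1 t + b * g1 t) (fun t => a * f2 t + b * g2 t).
  by move=> [? ?] [? ?]; split; exact: L2on_lin.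
have Wlin f1 f2 g1 g2 (a b : R) : FT f1 f2 -> FT g1 g2 -> forall x, J x ->
    W (fun t => a * f1 t + b * g1 t) (fun t => a * f2 t + b * g2 t) x =
    a * W f1 f2 x + b * W g1 g2 x.
  move=> F G x Jx; rewrite !WE//; last exact: FTlin.
  have Philin : Phi (fun t => a * f1 t + b * g1 t) (fun t => a * f2 t + b * g2 t) =
      fun s => a * Phi f1 f2 s + b * Phi g1 g2 s.
    by apply/funext => s; rewrite /Phi /free_wave; case: ifP => _; field.
  rewrite Philin (intop_lin J k M)//; first by ring.
  - by apply: L2on_integrable => //; exact: LPhi.
  - by apply: L2on_integrable => //; exact: LPhi.
(* The constant is halved because [nF] is twice the square norm of the free wave. *)
have lower f1 f2 : FT f1 f2 -> ((c / 2)%:E * nF f1 f2 <= sqnorm J (W f1 f2))%E.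
  move=> F; rewrite -nPhi// (eq_sqnorm J _ _ (WE _ _ F)) muleA -EFinM.
  by rewrite divfK//; exact/hc/LPhi.
split; first exact: WL.
split; first by move=> f1 f2 g1 g2 a b F G; apply: aeW => x Jx; exact: Wlin.
split.
  (* The same [C] serves, as the square norm of the free wave is at most its double [nF]. *)
  exists C; split => // f1 f2 F.
  have LF := LPhi _ _ F.
  rewrite (eq_sqnorm J _ _ (WE _ _ F)) (le_trans (hC _ LF))// -nPhi//.
  rewrite lee_wpmul2l ?lee_fin ?sqr_ge0// lee_pemull ?lee_fin//; last by lra.
  by apply: integral_ge0 => x _; rewrite lee_fin sqr_ge0.
split.
  move=> f1 f2 g1 g2 F G WFG.
  (* The lower bound for the difference of the two controls, whose image is null, forces both of its
     components to have norm zero. *)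
  have FG := FTlin f1 f2 g1 g2 1 (-1) F G.
  have := lower _ _ FG.
  have [_ [mW _]] := WL _ _ FG.
  have -> : sqnorm J (W (fun t => 1 * f1 t + -1 * g1 t)
                        (fun t => 1 * f2 t + -1 * g2 t)) = 0%E.
    apply/(sqnorm_eq0 J _ mJ mW); move: WFG.
    apply: filterS => [|x WFG Jx]; first exact: (ae_filter_ringOfSetsType mu).
    by rewrite Wlin// WFG//; ring.
  have [[_ [m1 _]] [_ [m2 _]]] := FG.
  have s0 (h : R -> R) : (0 <= sqnorm I h)%E.
    by apply: integral_ge0 => x _; rewrite lee_fin sqr_ge0.
  rewrite pmule_rle0 ?lte_fin ?divr_gt0// /nF.
  move=> n0; have := n0; rewrite le_eqVlt ltNge adde_ge0// orbF padde_eq0//.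
  move=> /andP[/eqP n1 /eqP n2].
  have ae0 (f g : R -> R) : ae_eq_on I (fun t => 1 * f t + -1 * g t) (fun=> 0) ->
      ae_eq_on I f g.
    apply: filterS => [|x fg Ix]; first exact: (ae_filter_ringOfSetsType mu).
    by have := fg Ix; rewrite mul1r mulN1r => /eqP; rewrite subr_eq0 => /eqP.
  split; apply: ae0.
    exact/(sqnorm_eq0 I _ mI m1).
  exact/(sqnorm_eq0 I _ mI m2).
split.
  move=> g Lg; have [phi [Lphi phiE]] := surj g Lg.
  have [f1 [f2 [Lf1 [Lf2 fE]]]] := free_wave_surjective T phi Lphi.
  exists f1, f2; split => //; apply: aeW => x Jx.
  by rewrite WE// /Phi fE phiE.
by exists (c / 2); split; [rewrite divr_gt0|exact: lower].
Qed.
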